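(* Let $G=(V,A)$ be a flow graph with start vertex $s$, let $T$ be a rooted tree with the parent property, and let $<$ be a preorder of $T$ that is low-high on $G$. For each vertex $v\neq s$ choose vertices $b(v),r(v)$ by applying exactly one of the following cases that applies (if Cases 1 and 2 both apply, either may be used): Case 1: there are arcs $(u,v),(w,v)\in A$ with $u<v<w$ and $w$ not a descendant of $v$ in $T$; choose two such arcs and set $b(v)=u$, $r(v)=w$. Case 2: $(t(v),v)\in A$ and there is another arc $(u,v)\in A$ with $u<v$; choose such an arc and set $b(v)=u$, $r(v)=t(v)$. Case 3: $(t(v),v)$ is the only arc entering $v$ from a non-descendant of $v$ in $T$; set $b(v)=r(v)=t(v)$. Let $B$ be the subgraph with vertex set $V$ and arcs $\{(b(v),v): v\neq s\}$ and $R$ the subgraph with vertex set $V$ and arcs $\{(r(v),v): v\neq s\}$. Then $B$ and $R$ are strongly independent spanning trees of $G$ rooted at $s$.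
   Context: A flow graph is a finite directed graph $G=(V,A)$ with a designated start vertex $s$ such that every vertex is reachable from $s$; throughout, there are no arcs entering $s$ and $|V|>1$. A vertex $v$ dominates $w$ if every path from $s$ to $w$ contains $v$. For a rooted tree $T$, $t(v)$ denotes the parent of $v$; ancestors and descendants include the vertex itself. $T$ has the parent property if for every arc $(v,w)\in A$, $t(w)$ is an ancestor of $v$ in $T$. A preorder of $T$ is a total order of its vertices such that for every vertex $v$, the descendants of $v$ are ordered consecutively with $v$ first. A preorder of $T$ is low-high on $G$ if for every $v\neq s$, either $(t(v),v)\in A$, or there are two arcs $(u,v),(w,v)\in A$ with $u<v<w$ and $w$ not a descendant of $v$ in $T$. For a spanning tree $B$ rooted at $s$, $B[s,v]$ denotes the path in $B$ from $s$ to $v$. Two spanning trees $B$, $R$ rooted at $s$ are strongly independent if for every pair of vertices $v,w$, either $B[s,v]$ and $R[s,w]$ share only vertices that dominate both $v$ and $w$, or $R[s,v]$ and $B[s,w]$ share only vertices that dominate both $v$ and $w$. *)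

(* Defs.v *)
From mathcomp Require Import all_boot.

Set Implicit Arguments.
Unset Strict Implicit.
Unset Printing Implicit Defensive.

(* A finite directed graph is an arc relation [A : rel V] on a finite type: *)
(* arcs are ordered pairs, so there are no parallel arcs.                   *)

Definition flow_graph (V : finType) (A : rel V) (s : V) : Prop :=
  [/\ 1 < #|V|, forall v, ~~ A v s & forall v, connect A s v].

Definition dominates (V : finType) (A : rel V) (s v w : V) : Prop :=
  forall p : seq V, path A s p -> last s p = w -> v \in s :: p.

(* The directed graph with vertex set [X] and arcs [E] is a tree rooted at  *)
(* [r], with arcs directed from parent to child.                            *)
Definition is_rooted_tree (V : finType) (X : {set V}) (E : rel V) (r : V)
    : Prop :=
  [/\ r \in X,
      forall u v, E u v -> (u \in X) && (v \in X),
      forall u, ~~ E u r,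
      forall v, v \in X -> v != r -> exists! u, E u v
    & forall v, v \in X -> connect E r v].

(* Neither the vertex set nor the root is fixed in advance: for a flow      *)
(* graph, the parent property forces them to be [V] and [s].                *)
Record rooted_tree (V : finType) := RootedTree {
  tree_verts : {set V};
  tree_root : V;
  is_parent : rel V; (* [is_parent p v] reads [p = t(v)] *)
  rooted_treeP : is_rooted_tree tree_verts is_parent tree_root
}.

Definition ancestor (V : finType) (T : rooted_tree V) : rel V :=
  fun u v => (u \in tree_verts T) && connect (is_parent T) u v.

Definition descendant (V : finType) (T : rooted_tree V) : rel V :=
  fun u v => ancestor T v u.

Definition parent_property (V : finType) (A : rel V) (T : rooted_tree V)
    : Prop :=
  forall v w, A v w -> exists2 p, is_parent T p w & ancestor T p v.

Definition strict_total_order_on (V : finType) (X : {set V}) (lt : rel V)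
    : Prop :=
  [/\ {in X, irreflexive lt},
      {in X & &, transitive lt}
    & {in X &, forall u v, u != v -> lt u v || lt v u}].

Definition tree_preorder (V : finType) (T : rooted_tree V) (lt : rel V)
    : Prop :=
  [/\ strict_total_order_on (tree_verts T) lt,
      forall u v, descendant T u v -> u != v -> lt v u
    & forall u v w x, descendant T u v -> descendant T w v ->
        x \in tree_verts T -> lt u x -> lt x w -> descendant T x v].

Definition low_high (V : finType) (A : rel V) (s : V) (T : rooted_tree V)
    (lt : rel V) : Prop :=
  forall v, v != s ->
    (exists2 p, is_parent T p v & A p v) \/
    (exists u w, [/\ A u v, A w v, lt u v, lt v w & ~~ descendant T w v]).

Definition choice_case1 (V : finType) (A : rel V) (T : rooted_tree V)
    (lt : rel V) (v bv rv : V) : Prop :=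
  [/\ A bv v, A rv v, lt bv v, lt v rv & ~~ descendant T rv v].

Definition choice_case2 (V : finType) (A : rel V) (T : rooted_tree V)
    (lt : rel V) (v bv rv : V) : Prop :=
  [/\ is_parent T rv v, A rv v, A bv v, bv != rv & lt bv v].

Definition choice_case3 (V : finType) (A : rel V) (T : rooted_tree V)
    (v bv rv : V) : Prop :=
  [/\ is_parent T rv v, A rv v,
      forall u, A u v -> ~~ descendant T u v -> u = rv
    & bv = rv].

(* The arcs (f(v), v) for v <> s; the value of [f] at [s] is irrelevant.    *)
Definition choice_arcs (V : finType) (s : V) (f : V -> V) : rel V :=
  fun u v => (v != s) && (u == f v).

Definition spanning_tree (V : finType) (A : rel V) (s : V) (E : rel V)
    : Prop :=
  subrel E A /\ is_rooted_tree [set: V] E s.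

(* [x] lies on E[s, v]; when [E] is a spanning tree rooted at [s], the path *)
(* [s :: p] exists and is unique.                                           *)
Definition on_tree_path (V : finType) (E : rel V) (s v x : V) : Prop :=
  exists p : seq V, [/\ path E s p, last s p = v & x \in s :: p].

Definition share_only_dominators (V : finType) (A : rel V) (s : V)
    (E F : rel V) (v w : V) : Prop :=
  forall x, on_tree_path E s v x -> on_tree_path F s w x ->
    dominates A s x v /\ dominates A s x w.

Definition strongly_independent (V : finType) (A : rel V) (s : V)
    (B R : rel V) : Prop :=
  forall v w, share_only_dominators A s B R v w \/
              share_only_dominators A s R B v w.

(* Main.v *)
Require Import Defs.
From mathcomp Require Import all_boot.

(** The parent property makes every ancestor in [T] a dominator: a path that
    enters the subtree of [x] can do so only at [x].  Besides the preorder
    [<], consider the preorder [<'] that visits siblings in the opposite order: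
    [x <' v] when [x] is a proper ancestor of [v], or [v < x] and [x] is not a
    descendant of [v].  A vertex [x] is an ancestor of [v] exactly when
    [x <= v] and [x <=' v].  Each case of the construction gives [b v < v] and
    [r v <' v], so the arcs of [B] increase along [<] and those of [R] along
    [<'].  If [v <= w] and [x] lies on both [B[s, v]] and [R[s, w]], then
    [x <= v <= w] and [x <=' w]; hence [x] is an ancestor of [w], and of [v]
    too because the descendants of [x] are consecutive. *)

Set Implicit Arguments.
Unset Strict Implicit.
Unset Printing Implicit Defensive.

Definition reflexive_closure (V : eqType) (o : rel V) : rel V :=
  fun u v => (u == v) || o u v.

Lemma reflexive_closure_trans (V : eqType) (o : rel V) :
  transitive o -> transitive (reflexive_closure o).
Proof.
move=> o_trans y x z /predU1P[->//|xy] /predU1P[<-|yz]; apply/orP; right=> //.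
exact: o_trans xy yz.
Qed.

Lemma connect_reflexive_closure (V : finType) (E o : rel V) :
  transitive o -> subrel E o -> subrel (connect E) (reflexive_closure o).
Proof.
move=> o_trans Eo x v /connectP[p /(sub_path Eo) xp ->]; apply/predU1P.
have /predU1P[->|in_p] := mem_last x p; first by left.
by right; apply: (allP (order_path_min o_trans xp)).
Qed.

Lemma connect_last_arc (V : finType) (E : rel V) (u v : V) :
  connect E u v -> u != v -> exists2 w, connect E u w & E w v.
Proof.
case/connectP=> p; case/lastP: p => [_ ->|p w]; first by rewrite eqxx.
rewrite rcons_path last_rcons => /andP[up pw] -> _.
by exists (last u p) => //; apply/connectP; exists p.
Qed.

Lemma finite_order_ind (V : finType) (o : rel V) (P : V -> Prop) :
    irreflexive o -> transitive o ->
    (forall v, (forall u, o u v -> P u) -> P v) ->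
  forall v, P v.
Proof.
move=> o_irr o_trans IHo v.
have [n] := ubnP #|[set u | o u v]|; elim: n v => // n IHn v.
rewrite ltnS => le_n; apply: IHo => u uv; apply: IHn.
apply: leq_trans le_n; apply/proper_card/properP; split.
  by apply/subsetP=> x; rewrite !inE => /o_trans; apply.
by exists u; rewrite !inE ?o_irr.
Qed.

Lemma on_tree_path_connect (V : finType) (E : rel V) (s v x : V) :
  on_tree_path E s v x -> connect E x v.
Proof.
case=> p [sp + x_in]; case/splitPl: x_in sp => p1 p2 <-.
by rewrite cat_path last_cat => /andP[_ p2P] p2v; apply/connectP; exists p2.
Qed.

Section ChoiceArcs.
Variables (V : finType) (s : V) (f : V -> V).

Lemma choice_arcs_sub (E : rel V) :
  (forall v, v != s -> E (f v) v) -> subrel (choice_arcs s f) E.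
Proof. by move=> fE u v /andP[vs /eqP->]; apply: fE. Qed.

Lemma choice_arcs_tree (o : rel V) :
    irreflexive o -> transitive o -> (forall v, v != s -> o (f v) v) ->
  is_rooted_tree [set: V] (choice_arcs s f) s.
Proof.
move=> o_irr o_trans fo.
have f_arc v : v != s -> choice_arcs s f (f v) v.
  by move=> vs; rewrite /choice_arcs vs eqxx.
split=> [|u v _|u|v _ vs|v _]; rewrite ?inE //.
- by rewrite /choice_arcs eqxx.
- by exists (f v); split=> [|u /andP[_ /eqP->]] //; apply: f_arc.
move: v; apply: (finite_order_ind o_irr o_trans) => v IHv.
have [-> //|vs] := eqVneq v s.
exact: connect_trans (IHv _ (fo v vs)) (connect1 (f_arc v vs)).
Qed.

End ChoiceArcs.

Section RootedTree.
Variables (V : finType) (T : rooted_tree V).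

Lemma is_parent_uniq p q v : is_parent T p v -> is_parent T q v -> p = q.
Proof.
have [_ arc_verts root_src parent_uniq _] := rooted_treeP T.
move=> pv qv; have /andP[_ Tv] := arc_verts _ _ pv.
have vr : v != tree_root T by apply: contraTneq pv => ->.
by have [u [_ uP]] := parent_uniq v Tv vr; rewrite -(uP _ pv) -(uP _ qv).
Qed.

Lemma is_parent_irr : irreflexive (is_parent T).
Proof.
have [_ arc_verts root_src _ root_conn] := rooted_treeP T.
move=> v; apply/negP=> vv; have /andP[Tv _] := arc_verts _ _ vv.
have /connectP[_ /shortenP[p + uniq_p _]] := root_conn v Tv.
case/lastP: p uniq_p => [_ _ /= v_root|p y].
  by have := root_src v; rewrite -v_root vv.
rewrite rcons_path last_rcons -rcons_cons rcons_uniq => /andP[yp _].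
case/andP=> _ py vy; rewrite -vy in py yp.
by rewrite -(is_parent_uniq py vv) mem_last in yp.
Qed.

Lemma ancestor_trans : transitive (ancestor T).
Proof.
move=> y x z /andP[Tx xy] /andP[_ yz]; rewrite /ancestor Tx.
exact: connect_trans xy yz.
Qed.

Lemma is_parent_ancestor p v : is_parent T p v -> ancestor T p v.
Proof.
have [_ arc_verts _ _ _] := rooted_treeP T.
move=> pv; have /andP[Tp _] := arc_verts _ _ pv.
by rewrite /ancestor Tp connect1.
Qed.

Lemma ancestor_parent x p v :
  is_parent T p v -> ancestor T x v -> x != v -> ancestor T x p.
Proof.
move=> pv /andP[Tx xv] /(connect_last_arc xv)[q xq qv].
by rewrite /ancestor Tx (is_parent_uniq pv qv).
Qed.

Lemma ancestor_root x : ancestor T x (tree_root T) -> x = tree_root T.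
Proof.
have [_ _ root_src _ _] := rooted_treeP T.
case/andP=> _ x_root; apply/eqP/negPn/negP=> /(connect_last_arc x_root)[p _].
exact/negP/root_src.
Qed.

End RootedTree.

Section ParentProperty.
Variables (V : finType) (A : rel V) (s : V) (T : rooted_tree V).
Hypothesis parentA : parent_property A T.

Lemma enters_subtree_at_root x u p :
    path A u p -> ~~ ancestor T x u -> ancestor T x (last u p) ->
  x \in p.
Proof.
elim: p u => [|v p IHp] u /=; first by move=> _ /negPf->.
case/andP=> uv vp xNu xp; rewrite inE.
have [//|xv] := eqVneq x v; apply: IHp vp _ xp.
apply: contra xNu => xv_anc; have [q qv qu] := parentA uv.
exact: ancestor_trans (ancestor_parent qv xv_anc xv) qu.
Qed.

Hypothesis flowA : flow_graph A s.

Lemma flow_graph_pred v : v != s -> exists u, A u v.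
Proof.
have [_ _ reachable] := flowA; rewrite eq_sym.
by case/(connect_last_arc (reachable v))=> u _ uv; exists u.
Qed.

Lemma parent_property_root : tree_root T = s.
Proof.
have [_ _ root_src _ _] := rooted_treeP T.
apply/eqP/negPn/negP=> /flow_graph_pred[u /parentA[p p_root _]].
by have := root_src p; rewrite p_root.
Qed.

Lemma parent_property_verts v : v \in tree_verts T.
Proof.
have [root_in arc_verts _ _ _] := rooted_treeP T.
have [->|vs] := eqVneq v s; first by rewrite -parent_property_root.
by have [u /parentA[p /arc_verts/andP[]]] := flow_graph_pred vs.
Qed.

Lemma ancestor_dominates x v : ancestor T x v -> dominates A s x v.
Proof.
move=> xv p sp pv; rewrite inE; have [//|xs /=] := eqVneq x s.
apply: enters_subtree_at_root sp _ _; last by rewrite pv.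
by apply: contra xs; rewrite -parent_property_root => /ancestor_root->.
Qed.

End ParentProperty.

Definition reverse_preorder (V : finType) (T : rooted_tree V) (lt : rel V)
    : rel V :=
  fun u v => lt u v && ancestor T u v || lt v u && ~~ ancestor T v u.

Section Preorder.
Variables (V : finType) (T : rooted_tree V) (lt : rel V).
Hypothesis preorderT : tree_preorder T lt.

Lemma is_parent_lt p v : is_parent T p v -> lt p v.
Proof.
have [_ ancestor_first _] := preorderT; move=> pv.
apply: ancestor_first; first exact: is_parent_ancestor.
by apply: contraTneq pv => ->; rewrite is_parent_irr.
Qed.

Lemma choice_increasing (A : rel V) v bv rv :
    [\/ choice_case1 A T lt v bv rv, choice_case2 A T lt v bv rv
      | choice_case3 A T v bv rv] ->
  [/\ A bv v, A rv v, lt bv v & reverse_preorder T lt rv v].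
Proof.
have parent_before p : is_parent T p v -> reverse_preorder T lt p v.
  by move=> pv; apply/orP; left; rewrite (is_parent_lt pv) is_parent_ancestor.
case=> [[bA rA b_lt v_lt rNv]|[r_par rA bA _ b_lt]|[r_par rA _ ->]].
- by split=> //; apply/orP; right; rewrite v_lt.
- by split=> //; apply: parent_before.
- by split=> //; [apply: is_parent_lt|apply: parent_before].
Qed.

Hypothesis spanT : forall v, v \in tree_verts T.

Lemma preorder_irr : irreflexive lt.
Proof. by have [[lt_irr _ _] _ _] := preorderT; move=> v; apply: lt_irr. Qed.

Lemma preorder_trans : transitive lt.
Proof.
by have [[_ lt_trans _] _ _] := preorderT; move=> v u w; apply: lt_trans.
Qed.

Lemma preorder_trichotomy u v : [\/ u = v, lt u v | lt v u].
Proof.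
have [[_ _ lt_total] _ _] := preorderT.
have [->|uv] := eqVneq u v; first exact: Or31.
have /orP[] := lt_total u v (spanT u) (spanT v) uv; first exact: Or32.
exact: Or33.
Qed.

Lemma ancestor_refl v : ancestor T v v.
Proof. by rewrite /ancestor spanT connect0. Qed.

Lemma ancestor_between u v w :
  ancestor T u w -> lt u v -> lt v w -> ancestor T u v.
Proof.
have [_ _ consecutive] := preorderT.
by move=> uw; apply: consecutive (ancestor_refl u) uw (spanT v).
Qed.

Lemma reverse_preorder_irr : irreflexive (reverse_preorder T lt).
Proof. by move=> v; rewrite /reverse_preorder preorder_irr. Qed.

Lemma reverse_preorder_trans : transitive (reverse_preorder T lt).
Proof.
move=> v u w /orP[/andP[uv anc_uv]|/andP[vu not_anc_vu]].
- case/orP=> [/andP[vw anc_vw]|/andP[wv not_anc_wv]]; apply/orP.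
    left; rewrite (preorder_trans uv vw); exact: ancestor_trans anc_uv anc_vw.
  have [uw|uw|wu] := preorder_trichotomy u w.
  + by rewrite -uw anc_uv in not_anc_wv.
  + by left; rewrite uw (ancestor_between anc_uv).
  + right; rewrite wu; apply: contra not_anc_wv => anc_wu.
    exact: ancestor_trans anc_wu anc_uv.
- case/orP=> [/andP[vw anc_vw]|/andP[wv not_anc_wv]]; apply/orP; right.
    have [uw|uw|wu] := preorder_trichotomy u w.
    + by rewrite uw anc_vw in not_anc_vu.
    + by rewrite (ancestor_between anc_vw vu uw) in not_anc_vu.
    + rewrite wu; apply: contra not_anc_vu; exact: ancestor_trans.
  rewrite (preorder_trans wv vu); apply: contra not_anc_wv => anc_wu.
  exact: ancestor_between anc_wu wv vu.
Qed.

Lemma ancestor_of_both_orders u v :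
    reflexive_closure lt u v ->
    reflexive_closure (reverse_preorder T lt) u v ->
  ancestor T u v.
Proof.
case/predU1P=> [->|uv]; first by rewrite ancestor_refl.
case/predU1P=> [->|/orP[/andP[]//|/andP[vu _]]]; first exact: ancestor_refl.
by have := preorder_trans uv vu; rewrite preorder_irr.
Qed.

Lemma common_ancestor x v w :
    reflexive_closure lt v w -> reflexive_closure lt x v ->
    reflexive_closure (reverse_preorder T lt) x w ->
  ancestor T x v /\ ancestor T x w.
Proof.
move=> vw xv xw_rev.
have xw : ancestor T x w.
  apply: ancestor_of_both_orders xw_rev.
  exact: (reflexive_closure_trans preorder_trans xv vw).
split=> //; case/predU1P: xv => [->|xv]; first exact: ancestor_refl.
case/predU1P: vw => [->//|vw]; exact: ancestor_between xw xv vw.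
Qed.

End Preorder.

Lemma increasing_strongly_independent (V : finType) (A : rel V) (s : V)
    (T : rooted_tree V) (lt B R : rel V) :
    flow_graph A s -> parent_property A T -> tree_preorder T lt ->
    subrel B lt -> subrel R (reverse_preorder T lt) ->
  strongly_independent A s B R.
Proof.
move=> flowA parentA preorderT B_lt R_rev.
have spanT := parent_property_verts parentA flowA.
have lt_trans := preorder_trans preorderT spanT.
have rev_trans := reverse_preorder_trans preorderT spanT.
have shared v w : reflexive_closure lt v w -> share_only_dominators A s B R v w.
  move=> vw x /on_tree_path_connect xv /on_tree_path_connect xw.
  have [] := common_ancestor preorderT spanT vw
    (connect_reflexive_closure lt_trans B_lt xv)
    (connect_reflexive_closure rev_trans R_rev xw).
  by split; apply: (ancestor_dominates parentA flowA).
move=> v w; have [->|vw|wv] := preorder_trichotomy preorderT spanT v w.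
- by left; apply: shared; rewrite /reflexive_closure eqxx.
- by left; apply: shared; rewrite /reflexive_closure vw orbT.
- right=> x xv xw; apply/and_comm; apply: shared xw xv.
  by rewrite /reflexive_closure wv orbT.
Qed.

Theorem theorem8 (V : finType) (A : rel V) (s : V) (T : rooted_tree V)
  (lt : rel V) (b r : V -> V)
  (hG : flow_graph A s)
  (hT : parent_property A T)
  (hpre : tree_preorder T lt)
  (hlh : low_high A s T lt)
  (hbr : forall v, v != s ->
     [\/ choice_case1 A T lt v (b v) (r v),
         choice_case2 A T lt v (b v) (r v)
       | choice_case3 A T v (b v) (r v)]) :
  [/\ spanning_tree A s (choice_arcs s b),
      spanning_tree A s (choice_arcs s r)
    & strongly_independent A s (choice_arcs s b) (choice_arcs s r)].
Proof.
have spanT := parent_property_verts hT hG.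
have chosen v vs := choice_increasing hpre (hbr v vs).
have b_lt v : v != s -> lt (b v) v by move=> /chosen[].
have r_rev v : v != s -> reverse_preorder T lt (r v) v by move=> /chosen[].
split.
- split; first by apply: choice_arcs_sub => v /chosen[].
  apply: choice_arcs_tree b_lt; first exact: preorder_irr hpre spanT.
  exact: preorder_trans hpre spanT.
- split; first by apply: choice_arcs_sub => v /chosen[].
  apply: choice_arcs_tree r_rev; first exact: reverse_preorder_irr hpre spanT.
  exact: reverse_preorder_trans hpre spanT.
- exact: increasing_strongly_independent hG hT hpre
    (choice_arcs_sub b_lt) (choice_arcs_sub r_rev).
Qed.
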